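(* Let $G$ be a metabelian $3$-group of non-maximal class with abelianisation $G/\gamma_2(G)$ of type $(3,3)$. Assume that $G$ has order $|G|=3^n$, class $\mathrm{cl}(G)=m-1$, and invariant $e=n-m+2\ge 3$, where $4\le m<n\le 2m-3$. Let generators of $G=\langle x,y\rangle$ be selected such that $\gamma_3(G)=\langle y^3,x^3,\gamma_4(G)\rangle$, $x\in G\setminus\chi_s(G)$ if $s<m-1$, and $y\in\chi_s(G)\setminus\gamma_2(G)$. Let the four maximal normal subgroups of $G$ be ordered by $M_i=\langle g_i,\gamma_2(G)\rangle$ with $g_1=y$, $g_2=x$, $g_3=xy$, $g_4=xy^{-1}$. Put $s_2=t_2=[y,x]\in\gamma_2(G)$ and recursively $s_j=[s_{j-1},x]$, $t_j=[t_{j-1},y]\in\gamma_j(G)$ for $j\ge 3$; put $\sigma_3=y^3$, $\tau_3=x^3\in\gamma_3(G)$ and $\sigma_j=[\sigma_{j-1},x]$, $\tau_j=[\tau_{j-1},y]\in\gamma_j(G)$ for $j\ge 4$. With exponents $-1\le\alpha,\beta,\gamma,\delta,\rho\le 1$, let the following relations be satisfied: $$s_2^3=\sigma_4\sigma_{m-1}^{-\rho\beta}\tau_4^{-1},\quad s_3\sigma_3\sigma_4=\sigma_{m-2}^{\rho\beta}\sigma_{m-1}^{\gamma}\tau_e^{\delta},\quad t_3^{-1}\tau_3\tau_4=\sigma_{m-2}^{\rho\delta}\sigma_{m-1}^{\alpha}\tau_e^{\beta},\quad \tau_{e+1}=\sigma_{m-1}^{-\rho}.$$ Finally, let $[\chi_s(G),\gamma_e(G)]=\gamma_{m-k}(G)$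 with $0\le k\le 1$. If $g\equiv x^jy^\ell\pmod{\gamma_2(G)}$ with $-1\le j,\ell\le 1$, then the images of the transfers $\mathrm{V}_i:G/\gamma_2(G)\to M_i/\gamma_2(M_i)$ are given by $$\mathrm{V}_1(g\gamma_2(G))=\begin{cases}\sigma_{m-1}^{\gamma\ell}\tau_e^{\delta\ell}\tau_3^{j}\gamma_2(M_1),&\text{if }[\chi_s(G),\gamma_e(G)]=1,\ k=0,\\ \sigma_{m-2}^{\rho\beta\ell}\sigma_{m-1}^{(\gamma-\rho\beta)\ell}\tau_e^{\delta\ell}\tau_3^{j}\gamma_2(M_1),&\text{if }[\chi_s(G),\gamma_e(G)]=\gamma_{m-1}(G),\ k=1,\ m\ge 5,\end{cases}$$ $$\mathrm{V}_2(g\gamma_2(G))=\begin{cases}\sigma_3^{\ell}\sigma_{m-1}^{\alpha j}\tau_e^{\beta j}\gamma_2(M_2),&\text{if }[\chi_s(G),\gamma_e(G)]=1,\ k=0,\\ \sigma_3^{\ell}\sigma_{m-2}^{\rho\delta j}\sigma_{m-1}^{(\alpha+\rho\beta)j}\tau_e^{\beta j}\gamma_2(M_2),&\text{if }[\chi_s(G),\gamma_e(G)]=\gamma_{m-1}(G),\ k=1,\ m\ge 5,\end{cases}$$ $$\mathrm{V}_i(g\gamma_2(G))=\sigma_3^{\ell}\tau_3^{j}\gamma_2(M_i)\quad\text{for }3\le i\le 4.$$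
   Context: Conventions: $[a,b]=a^{-1}b^{-1}ab$, $a^b=b^{-1}ab$. The lower central series is $\gamma_1(G)=G$, $\gamma_j(G)=[\gamma_{j-1}(G),G]$ for $j\ge 2$. Metabelian means that $\gamma_2(G)$ is abelian; non-maximal class means coclass $\mathrm{cc}(G)=n-\mathrm{cl}(G)\ge 2$; $m=\mathrm{cl}(G)+1$ is called the index of nilpotency. The invariant $e=e(G)$ is defined by $e+1=\min\{3\le j\le m\mid 1\le|\gamma_j(G)/\gamma_{j+1}(G)|\le 3\}$; it satisfies $e=n-m+2=\mathrm{cc}(G)+1$. For $2\le j\le m-1$, $\chi_j(G)$ is the largest subgroup of $G$ with $[\chi_j(G),\gamma_j(G)]\le\gamma_{j+2}(G)$, i.e. $\chi_j(G)=\{g\in G\mid[g,u]\in\gamma_{j+2}(G)\text{ for all }u\in\gamma_j(G)\}$. One has $\gamma_2(G)\le\chi_2(G)\le\cdots\le\chi_{m-2}(G)<\chi_{m-1}(G)=G$, and $s=s(G)=\min\{2\le j\le m-1\mid\chi_j(G)>\gamma_2(G)\}$. If $m=4$, then $k=0$ and $\rho=0$, and powers $\sigma_{m-2}^{0}$ are read as $1$. $\mathrm{V}_i$ is the usual group theoretic transfer homomorphism from $G$ to $M_i$. *)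

(* Defs.v *)
From HB Require Import structures.
From mathcomp Require Import all_boot all_order all_algebra all_fingroup all_solvable.

Set Implicit Arguments.
Unset Strict Implicit.
Unset Printing Implicit Defensive.

Import GRing.Theory.
Local Open Scope group_scope.

(* MathComp's [~ a, b] is a^-1 * b^-1 * a * b, and 'L_j(G) is the lower       *)
(* central series numbered from 'L_1(G) = G; 'L_2(G) and G^`(1) are           *)
(* convertible.                                                               *)

Definition expgz (gT : finGroupType) (g : gT) (z : int) : gT :=
  match z with Posz i => g ^+ i | Negz i => g ^- i.+1 end.

Arguments expgz {gT} g%_g z%_R.
Notation "g ^^ z" := (expgz g z) (at level 30, right associativity) :
  group_scope.

Definition is_least (P : nat -> Prop) (j : nat) : Prop :=
  P j /\ forall i : nat, P i -> (j <= i)%N.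

Definition metabelian (gT : finGroupType) (G : {group gT}) : bool :=
  abelian 'L_2(G).

Definition coclass (p : nat) (gT : finGroupType) (G : {group gT}) : nat :=
  logn p #|G| - nil_class G.

Definition is_invariant_e (gT : finGroupType) (G : {group gT}) (e : nat) :
    Prop :=
  is_least (fun j => [/\ (3 <= j <= (nil_class G).+1)%N
                      & (1 <= #|'L_j(G) / 'L_j.+1(G)| <= 3)%N]) e.+1.

Definition chi (gT : finGroupType) (j : nat) (G : {group gT}) : {set gT} :=
  [set g in G | [forall u in 'L_j(G), [~ g, u] \in 'L_j.+2(G)]].

Lemma chi_group_set (gT : finGroupType) (j : nat) (G : {group gT}) :
  group_set (chi j G).
Proof.
apply/group_setP; split=> [|g h].
  by rewrite inE group1; apply/forall_inP=> u _; rewrite comm1g group1.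
rewrite !inE => /andP[Gg /forall_inP cg] /andP[Gh /forall_inP ch].
rewrite groupM //=; apply/forall_inP=> u Lu.
rewrite commMgJ groupM ?ch // memJ_norm ?cg //.
exact: (subsetP (normal_norm (lcn_normal _ _))).
Qed.

Canonical chi_group (gT : finGroupType) (j : nat) (G : {group gT}) :
  {group gT} := Group (chi_group_set j G).

Definition is_invariant_s (gT : finGroupType) (G : {group gT}) (s : nat) :
    Prop :=
  is_least (fun j => [/\ (2 <= j <= nil_class G)%N
                      & 'L_2(G) \proper chi j G]) s.

(* For the sequences below only the indices j >= 2 (resp. j >= 3) are         *)
(* meaningful; smaller indices give the initial term.                         *)
Definition comm_iter (gT : finGroupType) (a z : gT) (i : nat) : gT :=
  iter i (fun u => [~ u, z]) a.

Definition s_seq (gT : finGroupType) (x y : gT) (j : nat) : gT :=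
  comm_iter [~ y, x] x (j - 2).

Definition t_seq (gT : finGroupType) (x y : gT) (j : nat) : gT :=
  comm_iter [~ y, x] y (j - 2).

Definition sigma (gT : finGroupType) (x y : gT) (j : nat) : gT :=
  comm_iter (y ^+ 3) x (j - 3).

Definition tau (gT : finGroupType) (x y : gT) (j : nat) : gT :=
  comm_iter (x ^+ 3) y (j - 3).

Definition Mgrp (gT : finGroupType) (G : {group gT}) (g : gT) : {group gT} :=
  (<[g]> <*> 'L_2(G))%G.

Section AbelianizedTransfer.

Variables (gT : finGroupType) (G H : {group gT}).

Definition abelianization : {morphism H >-> coset_of 'L_2(H)} :=
  restrm_morphism (normal_norm (lcn_normal 2 H)) (coset_morphism 'L_2(H)).

Lemma abelianization_abelian : abelian (abelianization @* H).
Proof. by rewrite morphim_restrm setIid; apply: sub_der1_abelian. Qed.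

Let T := transfer_morphism G abelianization_abelian.

Lemma ker_coset_transfer : 'ker (coset 'L_2(G)) \subset 'ker T.
Proof.
rewrite ker_coset ker_trivg_morphim lcn_sub /=.
rewrite (morphim_der T 1 (subxx G)) derg1.
have/commG1P->: T @* G \subset 'C(T @* G); last exact: subxx.
by apply/centsP=> u _ v _; apply: addrC.
Qed.

(* The map G / 'L_2(G) -> H / 'L_2(H) induced by the transfer from G to a     *)
(* subgroup H; MathComp's transfer takes its values in an additive copy of    *)
(* H / 'L_2(H), which fmval maps back, and is total (but only meaningful for  *)
(* H \subset G).                                                              *)
Definition Vtransfer (c : coset_of 'L_2(G)) : coset_of 'L_2(H) :=
  FiniteModule.fmval
    (factm ker_coset_transfer (normal_norm (lcn_normal 2 G)) c).

Lemma VtransferE (g : gT) : g \in G ->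
  Vtransfer (coset 'L_2(G) g)
    = FiniteModule.fmval (transfer G abelianization_abelian g).
Proof. by move=> Gg; rewrite /Vtransfer factmE. Qed.

End AbelianizedTransfer.

(* Main.v *)
(* Write A = G', an abelian group on which x and y act as commuting operators,
   and let M_i = <g_i, A>, a normal subgroup of index 3. The transfer to M_i
   sends h outside M_i to h^3, and g_i to g_i * g_i^h * g_i^(h^2), that is,
   modulo M_i', to g_i^3 * [g_i, h]^3 * [[g_i, h], h]. The given relations turn
   the latter into the stated expression, since [A, g_i] lies in M_i'; for
   i = 3, 4 neither x nor y is in M_i. The case k = 0 is the general formula
   with rho = 0: there sigma_{m-1}^(-rho) = tau_{e+1} lies in [chi_s, gamma_e]
   and is trivial, while sigma_{m-1} is not, as otherwise gamma_{m-1}, of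
   exponent 3, would be generated by tau_{m-1}: this is trivial if e < m - 1,
   and contradicts the minimality of e + 1 if e = m - 1. *)

Require Import Defs.
From mathcomp Require Import all_boot all_order all_algebra all_fingroup all_solvable.
From mathcomp Require Import zify.

Set Implicit Arguments.
Unset Strict Implicit.

Local Open Scope group_scope.
Import GRing.Theory.

(** * Integer powers, and the abelianization of a subgroup written additively *)

Lemma groupXz (gT : finGroupType) (H : {group gT}) a z :
  a \in H -> a ^^ z \in H.
Proof. by case: z => i Ha; rewrite /= ?groupV groupX. Qed.

Lemma invgXzN (gT : finGroupType) (a : gT) z : (a ^^ (- z))^-1 = a ^^ z.
Proof. by case: z => [[|i]|i] /=; rewrite ?invg1 ?invgK. Qed.

Section AdditiveAbelianization.

Variables (gT : finGroupType) (H : {group gT}).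

(* The projection H -> H / H', with values in the additive copy of H / H' used
   by [transfer]. *)
Definition fab (z : gT) : FiniteModule.fmod_of (abelianization_abelian H) :=
  FiniteModule.fmod (abelianization_abelian H) (abelianization H z).

Lemma abelianization_mem z :
  z \in H -> abelianization H z \in abelianization H @* H.
Proof. by move=> Hz; apply: mem_morphim. Qed.

Lemma fmval_fab z : z \in H -> FiniteModule.fmval (fab z) = coset 'L_2(H) z.
Proof. by move=> Hz; rewrite /fab FiniteModule.fmodK ?abelianization_mem. Qed.

Lemma fabM : {in H &, forall a b, fab (a * b) = (fab a + fab b)%R}.
Proof.
move=> a b Ha Hb; rewrite /fab -FiniteModule.fmodM ?abelianization_mem //.
by rewrite (morphM (abelianization H)).
Qed.

Canonical fab_morphism := Morphism fabM.

Lemma fabX i : {in H, forall a, fab (a ^+ i) = (fab a *+ i)%R}.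
Proof.
by move=> a Ha; rewrite [LHS](morphX fab_morphism) // FinRing.zmodXgE.
Qed.

Lemma fabV : {in H, forall a, fab a^-1 = (- fab a)%R}.
Proof. by move=> a Ha; rewrite [LHS](morphV fab_morphism). Qed.

Lemma fabXz z : {in H, forall a, fab (a ^^ z) = (fab a *~ z)%R}.
Proof.
by case: z => i a Ha; rewrite /= ?fabV ?groupX // fabX.
Qed.

Lemma fabJ : {in H &, forall a b, fab (a ^ b) = fab a}.
Proof.
move=> a b Ha Hb.
by rewrite conjgE !fabM ?groupM ?groupV // fabV // addrC addrK.
Qed.

Lemma fabR : {in H &, forall a b, fab [~ a, b] = 0%R}.
Proof.
move=> a b Ha Hb; rewrite commgEl fabM ?groupV ?groupJ // fabV // fabJ //.
by rewrite addNr.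
Qed.

Lemma fab_word2 u v p q : u \in H -> v \in H ->
  fab (u ^^ p * v ^^ q) = (fab u *~ p + fab v *~ q)%R.
Proof. by move=> Hu Hv; rewrite fabM ?groupXz // !fabXz. Qed.

Lemma fab_word3 u v w p q r : u \in H -> v \in H -> w \in H ->
  fab (u ^^ p * v ^^ q * w ^^ r) = (fab u *~ p + fab v *~ q + fab w *~ r)%R.
Proof.
by move=> Hu Hv Hw; rewrite fabM ?groupM ?groupXz // fab_word2 // fabXz.
Qed.

Lemma fab_word4 u v w z p q r t :
    u \in H -> v \in H -> w \in H -> z \in H ->
  fab (u ^^ p * v ^^ q * w ^^ r * z ^^ t)
    = (fab u *~ p + fab v *~ q + fab w *~ r + fab z *~ t)%R.
Proof.
by move=> Hu Hv Hw Hz; rewrite fabM ?groupM ?groupXz // fab_word3 // fabXz.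
Qed.

End AdditiveAbelianization.

(** * The transfer to a normal subgroup with cyclic quotient *)

Section CyclicTransfer.

Variables (gT : finGroupType) (G H : {group gT}) (h : gT).
Hypotheses (nsHG : H <| G) (Gh : h \in G) (defG : G \subset H * <[h]>).

Let T := transfer_morphism G (abelianization_abelian H).
Let sHG : H \subset G. Proof. exact: normal_sub. Qed.
Let nHh : h \in 'N(H). Proof. exact: (subsetP (normal_norm nsHG)). Qed.

Let defG' : H * <[h]> = G.
Proof.
by apply/eqP; rewrite eqEsubset defG mul_subG // cycle_subG.
Qed.

Lemma rcosets_cycle : rcosets H G = [set H :* u | u in <[h]>].
Proof.
apply/setP=> Hx; apply/rcosetsP/imsetP=> [[x Gx ->] | [u hu ->]].
  move: Gx; rewrite -defG' => /mulsgP[a u Ha hu ->]; exists u => //.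
  by rewrite rcosetM (rcoset_id Ha).
by exists u => //; apply: subsetP hu; rewrite cycle_subG.
Qed.

Lemma expg_indexg : h ^+ #|G : H| \in H.
Proof.
apply: coset_idr; rewrite ?groupX // morphX // -card_quotient ?normal_norm //.
by rewrite expg_cardG // mem_quotient.
Qed.

(** Reducing exponents modulo the index gives one inclusion, and counting gives equality. Negative
    powers are chosen because the transfer conjugates by inverses of representatives, so that
    [h ^- i] contributes [g ^ (h ^+ i)]. *)
Lemma rcosets_expg : rcosets H G = [set H :* (h ^- i) | i : 'I_#|G : H|].
Proof.
have r0 : 0 < #|G : H| by rewrite indexg_gt0.
have sub : rcosets H G \subset [set H :* (h ^- i) | i : 'I_#|G : H|].
  rewrite rcosets_cycle; apply/subsetP=> _ /imsetP[u hu ->].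
  have [j ->] : exists j, u = h ^- j.
    by move: hu; rewrite -cycleV => /cycleP[j ->]; exists j; rewrite expgVn.
  apply/imsetP; exists (Ordinal (ltn_pmod j r0)) => //=; apply/rcoset_eqP.
  rewrite mem_rcoset invgK {1}(divn_eq j #|G : H|) addnC expgD invMg.
  by rewrite -mulgA mulVg mulg1 groupV mulnC expgM groupX ?expg_indexg.
apply/eqP; rewrite eqEcard sub /=.
by apply: leq_trans (leq_imset_card _ _) _; rewrite card_ord.
Qed.

(** As [H] is normal, [g] fixes every right coset of [H], so each coset contributes one conjugate of
    [g]. *)
Lemma transfer_normal g : g \in H ->
  T g = (\sum_(i < #|G : H|) fab H (g ^ (h ^+ i)))%R.
Proof.
move=> Hg; rewrite [LHS]/= /transfer rcosets_expg big_imset /=; last first.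
  apply/imset_injP; rewrite -rcosets_expg card_ord; exact/eqP.
apply: eq_bigr => i _; set u := h ^- i.
have nHu : u \in 'N(H) by rewrite groupV groupX.
have Hgu : g ^ u^-1 \in H by rewrite memJ_norm // groupV.
have -> : H :* u :* g = H :* u.
  by rewrite -rcosetM; apply/rcoset_eqP;
     rewrite mem_rcoset -{1}[u]invgK -mulgA -conjgE.
(* The chosen representative is [a * u] with [a] in [H]; conjugation by [a] disappears in H / H'. *)
case: (repr_rcosetP H u) => a Ha.
have -> : a * u * g * (a * u)^-1 = (g ^ u^-1) ^ a^-1.
  by rewrite {Hgu nHu}; move: u => u; rewrite !conjgE !invgK invMg !mulgA.
by rewrite -[LHS]/(fab H _) fabJ ?groupV // invgK.
Qed.

(** Multiplication by [h] permutes the cosets of [H] in a single cycle, so the cycle expansion of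
    the transfer has one term, represented by 1, whose exponent is the length of the cycle. *)
Lemma transfer_gen : T h = fab H (h ^+ #|G : H|).
Proof.
have defHG : rcosets H G :* <[h]> = [set G : {set gT}].
  apply/setP=> B; rewrite inE.
  apply/mulsgP/eqP=> [[_ C /rcosetsP[x Gx ->] /set1P-> ->] | ->].
    have: x \in H * <[h]> by rewrite defG'.
    case/mulsgP=> a u Ha hu ->; rewrite rcosetM rcoset_id // -mulgA -defG'.
    by congr (_ * _); rewrite lcoset_id.
  exists (H : {set gT}) <[h]>; rewrite ?set11 //.
  by apply/rcosetsP; exists 1; rewrite ?rcoset1.
have trX : is_transversal [set 1] (rcosets H G :* <[h]>) G.
  rewrite defHG; apply/and3P; split.
  - rewrite /partition /cover big_set1 eqxx trivIset1 inE.
    by apply/eqP => G0; have := group1 G; rewrite -G0 inE.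
  - by rewrite sub1set.
  apply/forall_inP=> B /set1P->; apply/cards1P; exists 1.
  by apply/eqP; rewrite eqEsubset subsetIl subsetI !sub1set set11 group1.
rewrite [LHS](transfer_cycle_expansion sHG _ Gh trX) big_set1 invg1 conjg1.
rewrite rcoset1 -[LHS]/(fab H _); congr (fab H (h ^+ _)).
(* The cycle length is the index of [H] in [<[h]>]; since H<h> = G, counting identifies it with the
   index of [H] in [G]. *)
have /eqP := LagrangeMl H <[h]>.
by rewrite /= defG' -(Lagrange sHG) eqn_pmul2l // => /eqP.
Qed.

End CyclicTransfer.

(** * Maximal normal subgroups when the abelianization has type (3,3) *)

Lemma abelian_type_33 (gT : finGroupType) (Q : {group gT}) :
  abelian Q -> abelian_type Q = [:: 3; 3]%N ->
  #|Q| = 9 /\ {in Q, forall u, u ^+ 3 = 1}.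
Proof.
move=> abQ tQ; have [b defQ] := abelian_structure abQ.
rewrite tQ; case: b defQ => [|a [|c []]] //=.
rewrite big_cons big_seq1 => defQ [oa oc]; split.
  by rewrite -(dprod_card defQ) -!orderE oa oc.
have [_ eQ cac _] := dprodP defQ.
move=> u; rewrite -eQ => /mulsgP[_ _ /cycleP[i ->] /cycleP[j ->] ->].
have cij : commute (a ^+ i) (c ^+ j).
  by apply/commute_sym/(centsP cac); apply: mem_cycle.
rewrite expgMn // -!expgM ![(_ * 3)%N]mulnC !expgM -{1}oa -oc !expg_order.
by rewrite !expg1n mulg1.
Qed.

Section Maximal.

Variables (gT : finGroupType) (G : {group gT}) (g h : gT).
Hypotheses (abG : abelian_type (G / 'L_2(G)) = [:: 3; 3]%N).
Hypothesis genG : G :=: <<[set g; h]>>.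

Let Gg : g \in G. Proof. by rewrite genG mem_gen // !inE eqxx. Qed.
Let Gh : h \in G. Proof. by rewrite genG mem_gen // !inE eqxx orbT. Qed.

Lemma L2_sub_Mgrp a : 'L_2(G) \subset Mgrp G a.
Proof. exact: joing_subr. Qed.

Lemma mem_Mgrp a : a \in Mgrp G a.
Proof. by apply: (subsetP (joing_subl _ _)); rewrite cycle_id. Qed.

Lemma Mgrp_normal a : a \in G -> Mgrp G a <| G.
Proof.
move=> Ga; apply: sub_der1_normal; first exact: L2_sub_Mgrp.
by rewrite join_subG cycle_subG Ga lcn_sub.
Qed.

Lemma Mgrp_mul_cycle : G \subset Mgrp G g * <[h]>.
Proof.
have nMh : <[h]> \subset 'N(Mgrp G g).
  by rewrite cycle_subG (subsetP (normal_norm (Mgrp_normal Gg))).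
rewrite -norm_joinEr // {1}genG gen_subG; apply/subsetP=> z /set2P[] ->.
  by rewrite (subsetP (joing_subl _ _)) ?mem_Mgrp.
by rewrite (subsetP (joing_subr _ _)) ?cycle_id.
Qed.

Lemma expg3_L2 a : a \in G -> a ^+ 3 \in 'L_2(G).
Proof.
move=> Ga; have [_ e3] := abelian_type_33 (sub_der1_abelian (subxx _)) abG.
have nA := subsetP (normal_norm (lcn_normal 2 G)) _ Ga.
by apply: coset_idr; rewrite ?groupX // morphX // e3 // mem_quotient.
Qed.

(** Both factors of the chain G > M > G' are cyclic, generated by the images of [h] and [g], whose
    cubes lie in G'. So both indices divide 3, and their product is 9. *)
Lemma indexg_Mgrp : #|G : Mgrp G g| = 3.
Proof.
have [oQ _] := abelian_type_33 (sub_der1_abelian (subxx _)) abG.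
have nsA := lcn_normal 2 G; have nsM := Mgrp_normal Gg.
have nAg := subsetP (normal_norm nsA) _ Gg.
have nMh := subsetP (normal_norm nsM) _ Gh.
have d1 : #|G : Mgrp G g| %| 3.
  rewrite -card_quotient ?normal_norm //.
  have -> : G / Mgrp G g = <[coset (Mgrp G g) h]>.
    have eG : G = Mgrp G g * <[h]> :> {set gT}.
      by apply/eqP; rewrite eqEsubset Mgrp_mul_cycle mul_subG
                           ?(normal_sub nsM) ?cycle_subG.
    by rewrite {1}eG quotientMidl quotient_cycle.
  rewrite -orderE order_dvdn -morphX //= coset_id //.
  by rewrite (subsetP (L2_sub_Mgrp g)) ?expg3_L2.
have d2 : #|Mgrp G g : 'L_2(G)| %| 3.
  rewrite -card_quotient; last first.
    by rewrite (subset_trans (normal_sub nsM)) ?normal_norm.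
  have -> : Mgrp G g / 'L_2(G) = <[coset 'L_2(G) g]>.
    by rewrite -quotient_cycle // /= quotientYidr // cycle_subG.
  by rewrite -orderE order_dvdn -morphX //= coset_id ?expg3_L2.
have := Lagrange_index (normal_sub nsM) (L2_sub_Mgrp g).
rewrite -[#|G : 'L_2(G)|]card_quotient ?normal_norm // oQ.
move: (dvdn_leq (isT : 0 < 3) d1) (dvdn_leq (isT : 0 < 3) d2).
by case: #|G : _| => [|[|[|[|?]]]] //; case: #|_ : _| => [|[|[|[|?]]]].
Qed.

Let T := transfer_morphism G (abelianization_abelian (Mgrp G g)).

Lemma transfer_Mgrp_out : T h = fab (Mgrp G g) (h ^+ 3).
Proof.
by rewrite [LHS](transfer_gen (Mgrp_normal Gg) Gh Mgrp_mul_cycle) indexg_Mgrp.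
Qed.

(** With s = [g,h] and t = [s,h], the conjugates of [g] under 1, h, h^2 are g, gs and gs^2t; their
    classes are added in M/M'. *)
Lemma transfer_Mgrp_in :
  T g = (fab (Mgrp G g) g *+ 3 + fab (Mgrp G g) [~ g, h] *+ 3
          + fab (Mgrp G g) [~ [~ g, h], h])%R.
Proof.
rewrite [LHS](transfer_normal (Mgrp_normal Gg) Gh Mgrp_mul_cycle (mem_Mgrp g)).
have sAM := subsetP (L2_sub_Mgrp g).
have As : [~ g, h] \in 'L_2(G) by exact: mem_commg.
have At : [~ [~ g, h], h] \in 'L_2(G).
  by apply: (subsetP (lcn_sub_leq G (leqnSn 2))); apply: mem_commg.
rewrite indexg_Mgrp !big_ord_recl big_ord0 addr0 /= expg0 conjg1 expg1 conjgM.
have -> : g ^ h = g * [~ g, h] by rewrite commgEl mulKVg.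
rewrite conjMg.
have -> : g ^ h = g * [~ g, h] by rewrite commgEl mulKVg.
have -> : [~ g, h] ^ h = [~ g, h] * [~ [~ g, h], h].
  by rewrite [[~ [~ g, h], h]]commgEl mulKVg.
move: (sAM _ As) (sAM _ At) => {As At}.
move: [~ g, h] [~ [~ g, h], h] => s t Ms Mt.
rewrite !fabM ?groupM ?mem_Mgrp // !mulrS !mulr0n !addr0 !addrA.
by rewrite (ACl (1*2*4*3*5*6*7)%AC).
Qed.

(** This is the common shape of the relations for M_1 and M_2. The first hypothesis replaces
    [g,h]^3; its factor [b,g] vanishes in M/M' because [b] and [g] lie in M, and its factor [a]
    completes the left-hand side of the second hypothesis. *)
Lemma transfer_Mgrp_rel a b c w r :
  a \in 'L_2(G) -> b \in 'L_2(G) -> c \in 'L_2(G) ->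
  [~ g, h] ^+ 3 = a * c ^^ r * [~ b, g]^-1 ->
  [~ [~ g, h], h] * g ^+ 3 * a = w ->
  T g = (fab (Mgrp G g) w + fab (Mgrp G g) c *~ r)%R.
Proof.
have sAM z : z \in 'L_2(G) -> z \in Mgrp G g.
  exact: (subsetP (L2_sub_Mgrp g)).
have Mg := mem_Mgrp g.
move=> /sAM Ma /sAM Mb /sAM Mc; rewrite transfer_Mgrp_in.
have Ms : [~ g, h] \in Mgrp G g by apply: sAM; apply: mem_commg.
have Mt : [~ [~ g, h], h] \in Mgrp G g.
  by apply: sAM; apply: (subsetP (lcn_sub_leq G (leqnSn 2)));
     rewrite !mem_commg.
have Mbg : [~ b, g] \in Mgrp G g by rewrite groupR.
have fb : fab (Mgrp G g) [~ b, g] = 0%R by rewrite fabR.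
move: [~ g, h] [~ [~ g, h], h] [~ b, g] Ms Mt Mbg fb => s t bg Ms Mt Mbg fb.
rewrite -!fabX // => -> <-; rewrite !fabM ?groupM ?groupV ?groupX ?groupXz //.
rewrite fabV // fb subr0 fabXz // !addrA.
by rewrite (ACl (6*1*2*3*4*5)%AC).
Qed.

End Maximal.

(** The transfer kills G', its target being abelian, so only the word x^j y^l matters. *)
Lemma Vtransfer_word (gT : finGroupType) (G M : {group gT}) (x y g w : gT) j l
    (T := transfer_morphism G (abelianization_abelian M)) :
  x \in G -> y \in G -> g \in (x ^^ j * y ^^ l) *: 'L_2(G) -> w \in M ->
  (T x *~ j + T y *~ l = fab M w)%R ->
  Vtransfer M (coset 'L_2(G) g) = coset 'L_2(M) w.
Proof.
move=> Gx Gy /lcosetP[a Aa ->] Mw eqT.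
have Ga : a \in G := subsetP (lcn_sub 2 G) _ Aa.
have TXz z i : z \in G -> T (z ^^ i) = (T z *~ i)%R.
  by case: i => i Gz;
     rewrite /= ?(morphV T) ?groupX // (morphX T) // FinRing.zmodXgE.
rewrite VtransferE ?groupM ?groupXz // -[transfer _ _ _]/(T _).
rewrite !(morphM T) ?groupM ?groupXz // !TXz //.
have -> : T a = 0%R.
  have /(_ _)/mker := subsetP (ker_coset_transfer G M) a.
  by apply; rewrite ker_coset.
rewrite -fmval_fab // -eqT; congr (FiniteModule.fmval _).
(* The product left by [morphM] is by conversion the addition of the module. *)
exact: addr0.
Qed.

(** * Commutators in the lower central series of a metabelian group *)

(** Modulo the next term, a term of the series is generated by commutators of generators of the
    preceding term with [x] and [y]; here the mixed ones [a,y] and [b,x] are trivial. *)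
Lemma lcn_gen_step (gT : finGroupType) (G : {group gT}) (x y a b : gT) j :
  G :=: <<[set x; y]>> -> a \in 'L_j.+1(G) -> b \in 'L_j.+1(G) ->
  [~ a, y] = 1 -> [~ b, x] = 1 ->
  'L_j.+1(G) \subset <<[set a; b] :|: 'L_j.+2(G)>> ->
  'L_j.+2(G) \subset <<[set [~ a, x]; [~ b, y]] :|: 'L_j.+3(G)>>.
Proof.
move=> genG La Lb ay bx sL; set K := <<_ :|: 'L_j.+3(G)>>.
have Gx : x \in G by rewrite genG mem_gen // !inE eqxx.
have Gy : y \in G by rewrite genG mem_gen // !inE eqxx orbT.
have Kax : [~ a, x] \in K by rewrite mem_gen // !inE eqxx.
have Kby : [~ b, y] \in K by rewrite mem_gen // !inE eqxx orbT.
have sLK : 'L_j.+3(G) \subset K by apply: sub_gen; apply: subsetUr.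
have sKL : K \subset 'L_j.+2(G).
  rewrite gen_subG subUset lcn_sub_leq // andbT.
  by apply/subsetP=> _ /set2P[] ->; apply: mem_commg.
(* [K] lies between two consecutive terms of the series, so [K,G] lies in [K]. *)
have nKG : G \subset 'N(K).
  by rewrite -commg_subl (subset_trans (commSg _ sKL)).
change ([~: 'L_j.+1(G), G] \subset K).
apply: subset_trans (commSg _ sL) _.
have sSG : [set a; b] :|: 'L_j.+2(G) \subset G.
  rewrite subUset lcn_sub andbT; apply/subsetP=> _ /set2P[] ->.
    exact: (subsetP (lcn_sub _ _) _ La).
  exact: (subsetP (lcn_sub _ _) _ Lb).
have sXG : [set x; y] \subset G by rewrite genG subset_gen.
have nKS := subset_trans sSG nKG; have nKX := subset_trans sXG nKG.
(* Modulo [K] the claim says that two subgroups centralize each other, which can be checked on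
   generators of both. *)
rewrite [X in [~: _, X]]genG -quotient_cents2 ?gen_subG // !quotient_gen //.
rewrite cent_gen gen_subG quotient_cents2 // gen_subG.
apply/subsetP=> _ /imset2P[u v /setUP[Su | Lu] Xv ->].
  by case/set2P: Su => ->; case/set2P: Xv => ->; rewrite ?ay ?bx ?group1.
by apply: (subsetP sLK); apply: mem_commg => //; apply: (subsetP sXG).
Qed.

(** The commutator [x,y] acts trivially on the abelian group G', so [x] and [y] act on it as
    commuting operators; if [y] fixes [a], it fixes a^x and hence [a,x]. *)
Lemma commg_cent_comm (gT : finGroupType) (G : {group gT}) (a x y : gT) :
  metabelian G -> a \in 'L_2(G) -> x \in G -> y \in G ->
  [~ a, y] = 1 -> [~ [~ a, x], y] = 1.
Proof.
move=> metaG Aa Gx Gy ay1.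
have ay : a ^ y = a by rewrite conjg_mulR ay1 mulg1.
apply/eqP/conjg_fixP; rewrite commgEl conjMg conjVg ay.
congr (_ * _); rewrite -conjgM (commgC x y) conjgM conjgM ay.
have Aax : a ^ x \in 'L_2(G).
  by rewrite memJ_norm // (subsetP (normal_norm (lcn_normal _ _))).
apply/conjg_fixP/commgP; apply: (centsP metaG) => //.
exact: mem_commg.
Qed.

(** Commutation with [x] is an endomorphism of the abelian group G'. This turns t_3^-1 into
    [[x,y],y] in the third relation. *)
Lemma commVg_abelian (gT : finGroupType) (G : {group gT}) (a x : gT) :
  metabelian G -> a \in 'L_2(G) -> x \in G -> [~ a^-1, x] = [~ a, x]^-1.
Proof.
move=> metaG Aa Gx; rewrite !commgEl invMg !invgK conjVg.
apply: (centsP metaG) => //; rewrite groupV memJ_norm //.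
exact: (subsetP (normal_norm (lcn_normal _ _))).
Qed.

(** * The sequences sigma_j and tau_j as generators of the lower central factors *)

Section PowerSequences.

Variables (gT : finGroupType) (G : {group gT}) (x y : gT).
Hypothesis metaG : metabelian G.
Hypothesis abG : abelian_type (G / 'L_2(G)) = [:: 3; 3]%N.
Hypothesis genG : G :=: <<[set x; y]>>.
Hypothesis genL3 : 'L_3(G) = <<[set y ^+ 3; x ^+ 3] :|: 'L_4(G)>>.

Let Gx : x \in G. Proof. by rewrite genG mem_gen // !inE eqxx. Qed.
Let Gy : y \in G. Proof. by rewrite genG mem_gen // !inE eqxx orbT. Qed.

Lemma sigmaS j : sigma x y j.+4 = [~ sigma x y j.+3, x].
Proof. by rewrite /sigma /comm_iter !subSS !subn0. Qed.

Lemma tauS j : tau x y j.+4 = [~ tau x y j.+3, y].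
Proof. by rewrite /tau /comm_iter !subSS !subn0. Qed.

Lemma sigma_lcn j : sigma x y j.+3 \in 'L_j.+3(G).
Proof.
elim: j => [|j IHj]; last by rewrite sigmaS; apply: mem_commg.
by rewrite genL3 mem_gen // !inE eqxx.
Qed.

Lemma tau_lcn j : tau x y j.+3 \in 'L_j.+3(G).
Proof.
elim: j => [|j IHj]; last by rewrite tauS; apply: mem_commg.
by rewrite genL3 mem_gen // !inE eqxx orbT.
Qed.

(** The first term y^3 commutes with [y], and [commg_cent_comm] passes this on along the
    sequence. *)
Lemma sigma_comm_y j : [~ sigma x y j.+3, y] = 1.
Proof.
elim: j => [|j IHj]; first by apply/eqP/commgP; apply/commute_sym/commuteX.
rewrite sigmaS (commg_cent_comm metaG) //.
exact: (subsetP (lcn_sub_leq G (isT : 2 <= j.+3))) (sigma_lcn j).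
Qed.

Lemma tau_comm_x j : [~ tau x y j.+3, x] = 1.
Proof.
elim: j => [|j IHj]; first by apply/eqP/commgP; apply/commute_sym/commuteX.
rewrite tauS (commg_cent_comm metaG) //.
exact: (subsetP (lcn_sub_leq G (isT : 2 <= j.+3))) (tau_lcn j).
Qed.

Lemma lcn_sigma_tau j :
  'L_j.+3(G) \subset <<[set sigma x y j.+3; tau x y j.+3] :|: 'L_j.+4(G)>>.
Proof.
elim: j => [|j IHj]; first by rewrite {1}genL3.
rewrite sigmaS tauS; apply: lcn_gen_step => //; rewrite ?sigma_lcn ?tau_lcn //.
  exact: sigma_comm_y.
exact: tau_comm_x.
Qed.

(** The last term is central and generated by commutators [u,v] with [u] in G'. Hence [u,v]^3 =
    [u,v^3], which is trivial because v^3 also lies in the abelian group G'. *)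
Lemma last_lcn_cube j : 'L_j.+4(G) = 1 -> {in 'L_j.+3(G), forall u, u ^+ 3 = 1}.
Proof.
move=> L1.
have sLA : 'L_j.+2(G) \subset 'L_2(G) by apply: lcn_sub_leq.
have abS : abelian (commg_set 'L_j.+2(G) G).
  apply: abelianS metaG; apply: subset_trans (lcn_sub_leq G (isT : 2 <= j.+3)).
  exact: subset_gen.
suff /exponentP : exponent 'L_j.+3(G) %| 3 by [].
change (exponent <<commg_set 'L_j.+2(G) G>> %| 3).
rewrite abelian_exponent_gen //; apply/exponentP=> _ /imset2P[u v Lu Gv ->].
have cv : [~ [~ u, v], v] = 1.
  by apply/set1gP; rewrite -L1; do 2!apply: mem_commg => //.
rewrite -commgX; last by apply/commgP; rewrite -invg_comm cv invg1.
apply/eqP/commgP; apply: (centsP metaG); first exact: (subsetP sLA).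
exact: expg3_L2.
Qed.

Lemma sigma_last_neq1 e m :
  is_invariant_e G e.+3 -> nil_class G = m.+3 -> nilpotent G -> e <= m ->
  tau x y e.+4 = 1 -> sigma x y m.+3 != 1.
Proof.
move=> [_ minE] clG nilG em te1; apply/eqP=> s1.
have L1 : 'L_m.+4(G) = 1 by apply/lcn_nil_classP; rewrite ?clG.
have Ln1 : 'L_m.+3(G) != 1.
  by apply/eqP => /(lcn_nil_classP _ nilG); rewrite clG ltnn.
have sL : 'L_m.+3(G) \subset <[tau x y m.+3]>.
  have := lcn_sigma_tau m; rewrite s1 L1 => /subset_trans; apply.
  rewrite gen_subG; apply/subsetP=> z; rewrite !inE -orbA.
  by case/or3P=> /eqP->; rewrite ?group1 ?cycle_id.
have [em' | me] := ltnP e m; last first.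
  have eqe : e = m by apply/eqP; rewrite eqn_leq em.
  (* The last nontrivial term would be cyclic of order at most 3, so [e.+3] would already satisfy
     the condition whose least solution is [e.+4]. *)
  have := minE e.+3; rewrite ltnn => noe; suff : false by []; apply: noe.
  rewrite eqe; split; first by rewrite clG leqnSn.
  rewrite cardG_gt0 (leq_trans (leq_quotient _ _)) //.
  apply: leq_trans (subset_leq_card sL) _; rewrite dvdn_leq // order_dvdn.
  by rewrite (last_lcn_cube L1) ?tau_lcn.
(* Once trivial, the sequence tau stays trivial; it has become so by index [m.+3], the index of the
   generator of the last term. *)
have tk k : tau x y (e + k).+4 = 1.
  elim: k => [|k IHk]; first by rewrite addn0.
  by rewrite addnS tauS IHk comm1g.
case/negP: Ln1; rewrite -subG1; apply: subset_trans sL _.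
by rewrite -(subnKC em') tk cycle1.
Qed.

End PowerSequences.

(** * The images of the four transfers *)

Unset Implicit Arguments.
Theorem theorem3p1 (gT : finGroupType) (G : {group gT}) (n m e s k : nat)
    (x y : gT) (alpha beta gamma delta rho : int)
    (metabG : metabelian G)
    (nonmaxG : (2 <= coclass 3 G)%N)
    (abG : abelian_type (G / 'L_2(G)) = [:: 3; 3]%N)
    (oG : #|G| = (3 ^ n)%N)
    (clG : nil_class G = (m - 1)%N)
    (eG : is_invariant_e G e)
    (e_nm : e = (n - m + 2)%N)
    (e_ge3 : (3 <= e)%N)
    (m_ge4 : (4 <= m)%N) (m_lt_n : (m < n)%N) (n_le : (n <= 2 * m - 3)%N)
    (sG : is_invariant_s G s)
    (genG : G :=: <<[set x; y]>>)
    (genL3 : 'L_3(G) = <<[set y ^+ 3; x ^+ 3] :|: 'L_4(G)>>)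
    (xP : (s < m - 1)%N -> x \in G :\: chi s G)
    (yP : y \in chi s G :\: 'L_2(G))
    (alphaP : (- 1 <= alpha <= 1)%R) (betaP : (- 1 <= beta <= 1)%R)
    (gammaP : (- 1 <= gamma <= 1)%R) (deltaP : (- 1 <= delta <= 1)%R)
    (rhoP : (- 1 <= rho <= 1)%R)
    (rel1 : s_seq x y 2 ^+ 3
      = sigma x y 4 * sigma x y (m - 1) ^^ (- (rho * beta)) * (tau x y 4)^-1)
    (rel2 : s_seq x y 3 * sigma x y 3 * sigma x y 4
      = sigma x y (m - 2) ^^ (rho * beta) * sigma x y (m - 1) ^^ gamma
        * tau x y e ^^ delta)
    (rel3 : (t_seq x y 3)^-1 * tau x y 3 * tau x y 4
      = sigma x y (m - 2) ^^ (rho * delta) * sigma x y (m - 1) ^^ alpha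
        * tau x y e ^^ beta)
    (rel4 : tau x y e.+1 = sigma x y (m - 1) ^^ (- rho))
    (k_le1 : (k <= 1)%N)
    (kP : [~: chi s G, 'L_e(G)] = 'L_(m - k)(G))
    (m4P : m = 4 -> k = 0%N /\ rho = 0%R)
    (g : gT) (j l : int)
    (jP : (- 1 <= j <= 1)%R) (lP : (- 1 <= l <= 1)%R)
    (gP : g \in (x ^^ j * y ^^ l) *: 'L_2(G)) :
  let M1 := Mgrp G y in
  let M2 := Mgrp G x in
  let M3 := Mgrp G (x * y) in
  let M4 := Mgrp G (x * y^-1) in
  let c := coset 'L_2(G) g in
  [/\ [/\ [~: chi s G, 'L_e(G)] = 1 -> k = 0%N ->
            Vtransfer M1 c
              = coset 'L_2(M1) (sigma x y (m - 1) ^^ (gamma * l)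
                  * tau x y e ^^ (delta * l) * tau x y 3 ^^ j)
        & [~: chi s G, 'L_e(G)] = 'L_(m - 1)(G) -> k = 1%N -> (5 <= m)%N ->
            Vtransfer M1 c
              = coset 'L_2(M1) (sigma x y (m - 2) ^^ (rho * beta * l)
                  * sigma x y (m - 1) ^^ ((gamma - rho * beta) * l)
                  * tau x y e ^^ (delta * l) * tau x y 3 ^^ j)],
      [/\ [~: chi s G, 'L_e(G)] = 1 -> k = 0%N ->
            Vtransfer M2 c
              = coset 'L_2(M2) (sigma x y 3 ^^ l
                  * sigma x y (m - 1) ^^ (alpha * j) * tau x y e ^^ (beta * j))
        & [~: chi s G, 'L_e(G)] = 'L_(m - 1)(G) -> k = 1%N -> (5 <= m)%N ->
            Vtransfer M2 c
              = coset 'L_2(M2) (sigma x y 3 ^^ l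
                  * sigma x y (m - 2) ^^ (rho * delta * j)
                  * sigma x y (m - 1) ^^ ((alpha + rho * beta) * j)
                  * tau x y e ^^ (beta * j))],
      Vtransfer M3 c = coset 'L_2(M3) (sigma x y 3 ^^ l * tau x y 3 ^^ j)
    & Vtransfer M4 c = coset 'L_2(M4) (sigma x y 3 ^^ l * tau x y 3 ^^ j)].
Proof.
have Gx : x \in G by rewrite genG mem_gen // !inE eqxx.
have Gy : y \in G by rewrite genG mem_gen // !inE eqxx orbT.
have genyx : G :=: <<[set y; x]>> by rewrite genG setUC.
have gen2 g' h' : g' \in G -> h' \in G -> x \in <<[set g'; h']>> ->
    y \in <<[set g'; h']>> -> G :=: <<[set g'; h']>>.
  move=> Gg Gh xg yg; apply/eqP; rewrite eqEsubset {1}genG !gen_subG.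
  by apply/andP; split; apply/subsetP=> _ /set2P[] ->.
have in1 (g' h' : gT) : g' \in <<[set g'; h']>> by rewrite mem_gen // set21.
have in2 (g' h' : gT) : h' \in <<[set g'; h']>> by rewrite mem_gen // set22.
(* Each of [x] and [y] completes g_3 = xy, and likewise g_4 = xy^-1, to a generating pair, so that
   V_3 and V_4 send both to their cubes. *)
have genxyx : G :=: <<[set x * y; x]>>.
  apply: gen2 => //; first exact: groupM.
  by rewrite -{1}[y](mulKg x); apply: groupM; rewrite ?groupV;
     [apply: in2 | apply: in1].
have genxyy : G :=: <<[set x * y; y]>>.
  apply: gen2 => //; first exact: groupM.
  by rewrite -{1}[x](mulgK y); apply: groupM; rewrite ?groupV;
     [apply: in1 | apply: in2].
have genxVx : G :=: <<[set x * y^-1; x]>>.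
  apply: gen2 => //; first by rewrite groupM // groupV.
  rewrite -groupV -{1}[y^-1](mulKg x).
  by apply: groupM; rewrite ?groupV; [apply: in2 | apply: in1].
have genxVy : G :=: <<[set x * y^-1; y]>>.
  apply: gen2 => //; first by rewrite groupM // groupV.
  by rewrite -{1}[x](mulgKV y); apply: groupM; [apply: in1 | apply: in2].
have nilG : nilpotent G by apply: (@pgroup_nil _ 3); rewrite /pgroup oG pnatX.
(* From here [m] stands for the original index minus 4, so sigma_{m-1} and sigma_{m-2} have indices
   [m.+3] and [m.+2]; [e] is shifted by 3 below. *)
case: m => [|[|[|[|m]]]] // in clG e_nm m_ge4 m_lt_n n_le xP
  rel1 rel2 rel3 rel4 kP m4P *.
rewrite !subSS !subn0 in clG rel1 rel2 rel3 rel4 *.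
have Asigma i : sigma x y i.+3 \in 'L_2(G).
  exact: (subsetP (lcn_sub_leq G (isT : 2 <= i.+3))) (sigma_lcn genG genL3 i).
have Atau i : tau x y i.+3 \in 'L_2(G).
  exact: (subsetP (lcn_sub_leq G (isT : 2 <= i.+3))) (tau_lcn genG genL3 i).
(* For the smallest index of nilpotency this is [sigma x y 2], which truncated subtraction makes the
   initial term y^3. *)
have Asig2 : sigma x y m.+2 \in 'L_2(G).
  by case: (m) => [|i]; [exact: (Asigma 0) | exact: Asigma].
case: e => [|[|[|e]]] // in eG e_nm e_ge3 rel2 rel3 rel4 kP *.
have As : [~ y, x] \in 'L_2(G) by exact: mem_commg.
have At : [~ [~ y, x], x] \in 'L_2(G).
  by apply: (subsetP (lcn_sub_leq G (isT : 2 <= 3))); apply: mem_commg.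
have At' : [~ [~ y, x], y] \in 'L_2(G).
  by apply: (subsetP (lcn_sub_leq G (isT : 2 <= 3))); apply: mem_commg.
have rho0 : [~: chi s G, 'L_e.+3(G)] = 1 -> rho = 0%R.
  move=> c1.
  have te1 : tau x y e.+4 = 1.
    (* tau_{e+1} = [tau_e,y], where tau_e lies in gamma_e and [y] in chi_s. *)
    apply/set1gP; rewrite -c1 tauS; rewrite -[[~ _, _]]invgK invg_comm groupV.
    by apply: mem_commg; [case/setDP: yP | apply: tau_lcn].
  have em : e <= m by lia.
  have s1 := sigma_last_neq1 metabG abG genG genL3 eG clG nilG em te1.
  (* By the fourth relation, either value 1 or -1 would make sigma_{m-1} trivial. *)
  have : rho = (-1)%R \/ rho = 0%R \/ rho = 1%R by lia.
  case=> [|[]] // r; move: rel4 s1; rewrite te1 r => /esym E.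
    by case/eqP; rewrite -[LHS]expg1; exact: E.
  by case/eqP; apply: invg_inj; rewrite invg1 -[X in X^-1]expg1; exact: E.
set M1 := Mgrp G y; set M2 := Mgrp G x; set M3 := Mgrp G (x * y).
set M4 := Mgrp G (x * y^-1).
have sA1 := subsetP (L2_sub_Mgrp G y); have sA2 := subsetP (L2_sub_Mgrp G x).
have sA3 := subsetP (L2_sub_Mgrp G (x * y)).
have sA4 := subsetP (L2_sub_Mgrp G (x * y^-1)).
have T1x := transfer_Mgrp_out abG genyx.
have T1y : transfer_morphism G (abelianization_abelian M1) y =
    (fab M1 (sigma x y m.+2) *~ (rho * beta)
      + fab M1 (sigma x y m.+3) *~ (gamma - rho * beta)
      + fab M1 (tau x y e.+3) *~ delta)%R.
  (* Here a = sigma_4, [b,g] = [tau_3,y] = tau_4, and the exponent of sigma_{m-1} is -rho beta. *)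
  rewrite [LHS](transfer_Mgrp_rel abG genyx (Asigma 1%N) (Atau 0%N)
                                  (Asigma m) rel1 rel2).
  rewrite -/M1 fab_word3 ?sA1 // mulrNz mulrzBr.
  by rewrite addrAC addrA.
have T2y := transfer_Mgrp_out abG genG.
have T2x : transfer_morphism G (abelianization_abelian M2) x =
    (fab M2 (sigma x y m.+2) *~ (rho * delta)
      + fab M2 (sigma x y m.+3) *~ (alpha + rho * beta)
      + fab M2 (tau x y e.+3) *~ beta)%R.
  (* For M_2 the generators exchange roles: inverting the first relation gives a = tau_4 and [b,g] =
     [sigma_3,x] = sigma_4, and reverses the sign of rho beta. *)
  have rel1' : [~ x, y] ^+ 3
      = tau x y 4 * sigma x y m.+3 ^^ (rho * beta) * [~ sigma x y 3, x]^-1.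
    rewrite -(invg_comm y x) expgVn -[[~ y, x]]/(s_seq x y 2) rel1.
    rewrite (invMg _ (tau x y 4)^-1) (invMg (sigma x y 4)) invgK invgXzN.
    by rewrite mulgA.
  have rel3' : [~ [~ x, y], y] * x ^+ 3 * tau x y 4 =
      sigma x y m.+2 ^^ (rho * delta) * sigma x y m.+3 ^^ alpha
        * tau x y e.+3 ^^ beta.
    by rewrite -(invg_comm y x) (commVg_abelian metabG).
  rewrite [LHS](transfer_Mgrp_rel abG genG (Atau 1%N) (Asigma 0%N)
                                  (Asigma m) rel1' rel3').
  rewrite -/M2 fab_word3 ?sA2 // mulrzDr.
  by rewrite addrAC addrA.
have T3x := transfer_Mgrp_out abG genxyx.
have T3y := transfer_Mgrp_out abG genxyy.
have T4x := transfer_Mgrp_out abG genxVx.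
have T4y := transfer_Mgrp_out abG genxVy.
split; [split => [c1 _ | _ _ _] | split => [c1 _ | _ _ _] | |];
  apply: (Vtransfer_word Gx Gy gP).
- by rewrite !groupM ?groupXz ?sA1.
- rewrite [X in (X *~ j)%R]T1x [X in (X *~ l)%R]T1y (rho0 c1) mul0r subr0.
  rewrite fab_word3 ?sA1 // mulr0z add0r !mulrzA mulrzDl.
  by rewrite addrC.
- by rewrite !groupM ?groupXz ?sA1.
- rewrite [X in (X *~ j)%R]T1x [X in (X *~ l)%R]T1y.
  by rewrite fab_word4 ?sA1 // !mulrzDl -!mulrzA addrC.
- by rewrite !groupM ?groupXz ?sA2.
- rewrite [X in (X *~ j)%R]T2x [X in (X *~ l)%R]T2y (rho0 c1) !mul0r addr0.
  by rewrite fab_word3 ?sA2 // mulr0z add0r !mulrzDl -!mulrzA addrC addrA.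
- by rewrite !groupM ?groupXz ?sA2.
- rewrite [X in (X *~ j)%R]T2x [X in (X *~ l)%R]T2y.
  by rewrite fab_word4 ?sA2 // !mulrzDl -!mulrzA addrC !addrA.
- by rewrite !groupM ?groupXz ?sA3.
- rewrite [X in (X *~ j)%R]T3x [X in (X *~ l)%R]T3y.
  by rewrite fab_word2 ?sA3 // addrC.
- by rewrite !groupM ?groupXz ?sA4.
- rewrite [X in (X *~ j)%R]T4x [X in (X *~ l)%R]T4y.
  by rewrite fab_word2 ?sA4 // addrC.
Qed.
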